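(* Let $n,p,r$ be integers with $1\le p\le n$ and $1\le r\le n-p+1$. Then $|\mathcal{T}_n^{(r,p)}|=\Delta^{r-1}\big(B_{n-p+1-r,p}\big)=\sum_{j=0}^{r-1}(-1)^{r-1-j}\binom{r-1}{j}B_{n-p+1-r+j,\,p}$, where $\Delta$ is the forward difference operator acting on the first index.
   Context: Sites are the integers $0,1,\dots,n+1$. A configuration in $\mathcal{S}(n,p)$ is a placement of $n+1$ distinct chips labeled $1,\dots,n+1$ such that sites $0,n+1$ are empty, every site in $\{1,\dots,n\}\setminus\{p\}$ holds exactly one chip and site $p$ holds exactly two chips. Toppling: while some site holds at least two chips, choose such a site $i$ and two chips $\alpha<\beta$ there and move $\alpha$ to site $i-1$, $\beta$ to site $i+1$. It is known this terminates with at most one chip per site, within sites $0,\dots,n+1$, and the final configuration is independent of the choices; reading labels left to right gives a permutation of $[n+1]$. For $\pi=\pi_1\cdots\pi_n\in S_n$ and $r\in[n+1]$, the configuration $\pi^{(r,p)}\in\mathcal{S}(n,p)$ places at site $i$ ($1\le i\le n$) the chip $\pi_i$ if $\pi_i<r$ and $\pi_i+1$ if $\pi_i\ge r$, and places in addition the chip $r$ at site $p$. $\mathcal{T}_n^{(r,p)}$ is the set of $\pi\in S_n$ such that toppling $\pi^{(r,p)}$ yields the identity permutation. Forward difference: $\Delta f(m)=f(m+1)-f(m)$, $\Delta^{k}$ its $k$-fold composition, $\Delta^0 f=f$. Poly-Bernoulli numbers of type B: $\sum_{n\ge0}B_{n,k}\frac{x^n}{n!}=\frac{\mathrm{Li}_{-k}(1-e^{-x})}{1-e^{-x}}$,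 $\mathrm{Li}_s(z)=\sum_{i\ge1}z^i/i^s$; equivalently $B_{n,k}=\sum_{m=0}^{\min(n,k)}(m!)^2\left\{{n+1\atop m+1}\right\}\left\{{k+1\atop m+1}\right\}$. *)

(* Defs.v *)
From mathcomp Require Import all_boot all_order all_algebra all_fingroup.
Unset Printing Implicit Defensive.
Import GRing.Theory Num.Theory.

(** Configurations: a (multi)set of chip labels at every integer site.
    Sites are integers so that a toppling at site 0 would be representable
    (it is known never to happen from the configurations considered). *)
Definition config := int -> seq nat.

Definition topple_step (c c' : config) : Prop :=
  exists (i : int) (a b : nat),
    [/\ (a < b)%N, a \in c i & b \in c i] /\
    [/\ c' i = rem a (rem b (c i)),
        c' (i - 1)%R = a :: c (i - 1)%R,
        c' (i + 1)%R = b :: c (i + 1)%R &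
        forall j, j != i -> j != (i - 1)%R -> j != (i + 1)%R -> c' j = c j].

Inductive topple_reach : config -> config -> Prop :=
| reach_refl c : topple_reach c c
| reach_step c c' c'' : topple_step c c' -> topple_reach c' c'' -> topple_reach c c''.

Definition stable (c : config) : Prop := forall i, (size (c i) <= 1)%N.

Definition reading (n : nat) (c : config) : seq nat :=
  flatten [seq c (Posz i) | i <- iota 0 n.+2].

(** Toppling c yields the identity permutation of [n+1]: the (choice
    independent) final stable configuration reads 1, 2, ..., n+1. *)
Definition topples_to_id (n : nat) (c : config) : Prop :=
  exists c', [/\ topple_reach c c', stable c' & reading n c' = iota 1 n.+1].

(** The configuration pi^(r,p) for pi in S_n, written with 1-based values:
    pi_i = (s (i-1)) + 1 for s : 'S_n. *)
Definition init_config (n p r : nat) (s : 'S_n) : config :=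
  fun z => match z with
  | Posz i =>
      (if (0 < i)%N then
         match @insub nat (fun k => (k < n)%N) _ i.-1 with
         | Some k => let v := (s k).+1 in [:: if (v < r)%N then v else v.+1]
         | None => [::]
         end
       else [::]) ++ (if i == p then [:: r] else [::])
  | Negz _ => [::]
  end.

Definition in_T (n p r : nat) (s : 'S_n) : Prop :=
  topples_to_id n (init_config n p r s).

Fixpoint stirling2 (n k : nat) : nat :=
  match n, k with
  | 0, 0 => 1
  | 0, _.+1 => 0
  | _.+1, 0 => 0
  | n'.+1, k'.+1 => k * stirling2 n' k + stirling2 n' k'
  end.

Definition polyBernB (n k : nat) : nat :=
  \sum_(m < (minn n k).+1) (m`! ^ 2 * stirling2 n.+1 m.+1 * stirling2 k.+1 m.+1).

Definition fdiff (f : nat -> int) : nat -> int := fun m => (f m.+1 - f m)%R.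

(* Main.v *)
(** A reachable configuration is recorded by a word in two letters: "right" chips, at index [k]
    of the word and site [k + 1], and "left" chips, at index [k] and site [k]. Two chips share
    a site exactly when a right chip immediately precedes a left one, and toppling turns this
    factor into left-right, the smaller label going first. For a chip [v], consider the
    conditions that fewer than [v] left chips precede it and that [v] plus the number of right
    chips after it is at most [n + 1]: their conjunction over all chips is unchanged by a
    toppling, and in a stable state it says exactly that the labels are in increasing order.
    So the permutations toppling to the identity are those with graph in an explicit board.
    Comparing the boards for [r] and [r + 1], which differ by one cell, gives the forward
    difference; for [r = 1] the board consists of two triangles on the antidiagonal and two
    full blocks, and placing chips row by row in the triangles produces the Stirling numbers. *)
Require Import Defs.
From mathcomp Require Import all_boot all_order all_algebra all_fingroup.
From mathcomp Require Import zify ring.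
Import GRing.Theory Num.Theory.

(** * Permutations in a board *)

(** The permanent of the 0-1 matrix with support [R], or the number of placements of [n]
    non-attacking rooks on [R]. *)
Definition board_perms (n : nat) (R : nat -> nat -> bool) : nat :=
  \sum_(s : 'S_n) [forall i : 'I_n, R i (s i)].

Definition minor (R : nat -> nat -> bool) (i c : nat) : nat -> nat -> bool :=
  fun a b => R (bump i a) (bump c b).

Lemma eq_board_perms n (R R' : nat -> nat -> bool) :
  (forall i v, i < n -> v < n -> R i v = R' i v) ->
  board_perms n R = board_perms n R'.
Proof.
move=> eqR; apply: eq_bigr => s _; congr nat_of_bool.
by apply: eq_forallb => i; apply: eqR.
Qed.

Lemma board_permsT n R :
  board_perms n R = board_perms n (fun i v => R v i).
Proof.
rewrite /board_perms (reindex_inj invg_inj) /=; apply: eq_bigr => s _.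
congr nat_of_bool; apply/forallP/forallP => Rs i.
  by have := Rs (s i); rewrite permK.
by have := Rs (s^-1%g i); rewrite permKV.
Qed.

Lemma sum_perm_lift n (i c : 'I_n.+1) (F : 'S_n.+1 -> nat) :
  \sum_(s : 'S_n.+1 | s i == c) F s = \sum_(s : 'S_n) F (lift_perm i c s).
Proof.
(* The inverse of [lift_perm i c] deletes position [i] and its value; injectivity of [s] keeps
   [unlift] off the default. *)
pose u (s : 'S_n.+1) (k : 'I_n) := odflt k (unlift (s i) (s (lift i k))).
have uK (s : 'S_n.+1) k : lift (s i) (u s k) = s (lift i k).
  rewrite /u; have nik : s i != s (lift i k) by rewrite inj_eq ?neq_lift //; exact: perm_inj.
  by have [k' -> _] := unlift_some nik; rewrite liftK.
have uI (s : 'S_n.+1) : injective (u s).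
  move=> k l /(congr1 (lift (s i))); rewrite !uK => /perm_inj; exact: lift_inj.
rewrite (reindex (lift_perm i c)) /=.
  by apply: eq_bigl => s; rewrite lift_perm_id eqxx.
exists (fun s : 'S_n.+1 => perm (uI s)) => [s _ | s /eqP si].
  apply/permP=> k; rewrite permE; apply: (@lift_inj _ c).
  by have := uK (lift_perm i c s) k; rewrite lift_perm_id lift_perm_lift.
apply/permP=> k; case: (unliftP i k) => [k' ->|->]; last by rewrite lift_perm_id.
by rewrite lift_perm_lift permE -si uK.
Qed.

(** Laplace expansion of the permanent along row [i]. *)
Lemma board_perms_expand n R i : i < n.+1 ->
  board_perms n.+1 R = \sum_(c < n.+1) R i c * board_perms n (minor R i c).
Proof.
move=> lt_in; pose i0 := Ordinal lt_in.
rewrite /board_perms (partition_big (fun s : 'S_n.+1 => s i0) predT) //=.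
apply: eq_bigr => c _; rewrite sum_perm_lift big_distrr /=; apply: eq_bigr => s _.
rewrite mulnb; congr nat_of_bool; apply/forallP/andP => [Rs | [Ric /forallP Rs] k].
  split; first by have := Rs i0; rewrite lift_perm_id.
  by apply/forallP => k; have := Rs (lift i0 k); rewrite lift_perm_lift.
case: (unliftP i0 k) => [k' ->|->]; last by rewrite lift_perm_id.
by rewrite lift_perm_lift; apply: Rs.
Qed.

(** Rook deletion: split the permutations according to whether they use the cell [(i, c)]. *)
Lemma board_perms_del_cell n (R R' : nat -> nat -> bool) i c : i < n.+1 -> c < n.+1 ->
  R i c -> ~~ R' i c ->
  (forall a b, a < n.+1 -> b < n.+1 -> (a != i) || (b != c) -> R a b = R' a b) ->
  board_perms n.+1 R = board_perms n.+1 R' + board_perms n (minor R i c).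
Proof.
move=> lt_i lt_c Ric R'ic eqR; rewrite !(@board_perms_expand n _ i) //.
rewrite (bigD1 (Ordinal lt_c)) //= [in RHS](bigD1 (Ordinal lt_c)) //=.
rewrite Ric (negPf R'ic) mul1n mul0n add0n addnC; congr addn.
apply: eq_bigr => b nbc; congr muln; first by rewrite eqR ?nbc ?orbT.
apply: eq_board_perms => a d lt_a lt_d; rewrite /minor eqR //; last first.
- by rewrite eq_sym neq_bump.
- by rewrite /bump; lia.
- by rewrite /bump; lia.
Qed.

(* Off the diagonal blocks, which are full, two staircases: the rows below [u + a] meet the
   columns from [w + b] on along the cells [v' <= i], except that the first [u] of these rows
   are empty there; the other block is the transpose of this pattern for [w] and [b]. Thus [u]
   counts the rows already known to use a full block. *)
Definition stairs (u a w b : nat) : nat -> nat -> bool := fun i v =>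
  if i < u + a then (v < w + b) || (u <= i) && (v - (w + b) <= i)
  else (w + b <= v) || (w <= v) && (i - (u + a) <= v).

Lemma stairsE u a w b i v : stairs u a w b i v =
  (i < u + a) && ((v < w + b) || (u <= i) && (v - (w + b) <= i)) ||
  (u + a <= i) && ((w + b <= v) || (w <= v) && (i - (u + a) <= v)).
Proof. by rewrite /stairs; case: ltnP => //=; rewrite orbF. Qed.

Definition nstairs (u a w b : nat) : nat :=
  board_perms (u + a + (w + b)) (stairs u a w b).

Lemma nstairsC u a w b : nstairs u a w b = nstairs w b u a.
Proof.
rewrite /nstairs board_permsT addnC; apply: eq_board_perms => i v _ _.
by rewrite !stairsE; lia.
Qed.

(** Expand along row [u], the first staircase row not yet emptied. Each of its [u + 1] staircase
    cells leaves a board of the same shape with one row fewer; its cells in the full block give the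
    expansion of the board where this row is emptied. *)
Lemma nstairsS u a w b :
  nstairs u a.+1 w b = nstairs u.+1 a w b + u.+1 * nstairs u a w b.
Proof.
rewrite /nstairs addSn addnS !addSn.
rewrite !(@board_perms_expand _ _ u) ?ltnS -?addnA ?leq_addr //.
have E : (u + (a + (w + b))).+1 = w + b + (u.+1 + a) by lia.
rewrite !E !(@big_split_ord _ _ _ (w + b) (u.+1 + a)) /=.
rewrite [X in _ = _ + X + _]big1 => [|c _]; last first.
  by rewrite (_ : stairs _ _ _ _ _ _ = false) // !stairsE /=; lia.
rewrite addn0 (@big_split_ord _ _ _ u.+1 a) /= [X in _ + (_ + X)]big1 => [|c _]; last first.
  by rewrite (_ : stairs _ _ _ _ _ _ = false) // !stairsE /=; lia.
rewrite addn0; congr addn; last rewrite -[X in X * _]card_ord -sum_nat_const.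
  apply: eq_bigr => c _; have lt_c := ltn_ord c; congr muln; first by rewrite !stairsE; lia.
  by apply: eq_board_perms => i v _ _; rewrite /minor !stairsE /bump; lia.
apply: eq_bigr => c _; have lt_c := ltn_ord c.
have -> : stairs u a.+1 w b u (w + b + c) by rewrite !stairsE; lia.
rewrite mul1n; apply: eq_board_perms => i v _ _.
by rewrite /minor !stairsE /bump; lia.
Qed.

Lemma board_perms_true n (R : nat -> nat -> bool) :
  (forall i v, i < n -> v < n -> R i v) -> board_perms n R = n`!.
Proof.
move=> RT; rewrite -card_Sn -sum1_card /board_perms.
apply: congr_big => [//|s|s _]; first by rewrite inE.
by rewrite (_ : [forall i, _]) //; apply/forallP => i; apply: RT.
Qed.

Lemma board_perms_empty_row n (R : nat -> nat -> bool) i : i < n ->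
  (forall v, v < n -> ~~ R i v) -> board_perms n R = 0.
Proof.
case: n => // n lt_in R0; rewrite (board_perms_expand _ _ _ lt_in) big1 // => c _.
by rewrite (negPf (R0 _ _)).
Qed.

Lemma sum_ord_lt n x : x <= n -> \sum_(c < n) (c < x : nat) = x.
Proof.
move=> le_xn; rewrite -[RHS]card_ord -sum1_card (big_ord_widen n (fun=> 1)) //.
by rewrite [RHS]big_mkcond; apply: eq_bigr => c _; case: (c < x).
Qed.

(** The rows below [u] must be matched bijectively with the columns below [x], which forces
    [u = x]. *)
Lemma board_perms_blocks n u x : u <= n -> x <= n ->
  board_perms n (fun i v => (i < u) == (v < x)) = (u == x) * (u`! * (n - u)`!).
Proof.
elim: u n x => [|u IHu] [|n] [|x] // le_un le_xn.
- by rewrite board_perms_true // mul1n mul1n subn0.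
- by rewrite board_perms_true // mul1n mul1n subn0.
- by rewrite board_permsT (@board_perms_empty_row _ _ 0).
- by rewrite (@board_perms_empty_row _ _ 0).
rewrite (board_perms_expand _ _ 0) // eqSS factS subSS.
rewrite (eq_bigr (fun c : 'I_n.+1 => (c < x.+1) * ((u == x) * (u`! * (n - u)`!)))).
  by rewrite -big_distrl /= sum_ord_lt //; case: eqVneq => [->|]; lia.
move=> c _; rewrite eq_sym ltnS eqb_id; case: (leqP c x) => // le_cx; rewrite -IHu //.
congr muln; apply: eq_board_perms => i v _ _; rewrite /minor /bump; lia.
Qed.

Lemma stirling2_gt n m : n < m -> stirling2 n m = 0.
Proof. by elim: n m => [|n IHn] [|m] //= lt_nm; rewrite !IHn ?muln0 //; lia. Qed.

(** Apply [nstairsS] to [t] rows in turn, [x] counting those sent to the full block. The next row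
    enters the staircase in [x + 1] ways or raises [x]: the Stirling recurrence with both indices
    shifted by one. *)
Lemma nstairs_stirling t p w b : t <= p ->
  nstairs 0 p w b = \sum_(x < t.+1) stirling2 t.+1 x.+1 * nstairs x (p - t) w b.
Proof.
elim: t => [|t IHt] lt_tp; first by rewrite big_ord1 subn0 mul1n.
rewrite IHt 1?ltnW //; have -> : p - t = (p - t.+1).+1 by lia.
rewrite (eq_bigr (fun x : 'I_t.+1 => x.+1 * stirling2 t.+1 x.+1 * nstairs x (p - t.+1) w b
   + stirling2 t.+1 x.+1 * nstairs x.+1 (p - t.+1) w b)); last first.
  by move=> x _; rewrite nstairsS; nia.
rewrite [RHS](eq_bigr (fun x : 'I_t.+2 => x.+1 * stirling2 t.+1 x.+1 * nstairs x (p - t.+1) w b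
   + stirling2 t.+1 x * nstairs x (p - t.+1) w b)); last first.
  by move=> x _; rewrite -mulnDl.
(* The index ranges differ by one boundary term in each sum, zero since [stirling2 t.+1 0] and
   [stirling2 t.+1 t.+2] vanish. *)
rewrite !big_split /=; congr addn; last by rewrite [RHS]big_ord_recl /= mul0n add0n.
by rewrite [RHS]big_ord_recr /= !stirling2_gt // !(muln0, addn0).
Qed.

Lemma nstairs_base x y : nstairs y 0 x 0 = (y == x) * x`! ^ 2.
Proof.
rewrite /nstairs !addn0.
rewrite (@eq_board_perms _ _ (fun i v => (i < y) == (v < x))) => [|i v _ _]; last first.
  by rewrite stairsE; lia.
by rewrite board_perms_blocks ?leq_addr ?leq_addl // addKn; case: eqVneq => // ->.
Qed.

(* Vesztergombi's theorem: on [p + k] indices, [stairs 0 p 0 k i v] amounts to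
   [v <= i + k] and [i <= v + p]. *)
Lemma nstairs_polyBernB p k : nstairs 0 p 0 k = polyBernB k p.
Proof.
rewrite (@nstairs_stirling p) // subnn /polyBernB.
rewrite (@big_ord_widen _ _ _ _ p.+1
  (fun m => m`! ^ 2 * stirling2 k.+1 m.+1 * stirling2 p.+1 m.+1)); last by lia.
rewrite [RHS]big_mkcond; apply: eq_bigr => x _.
(* The other staircase is treated after transposition; by [nstairs_base] only the diagonal [y = x]
   of the double sum survives. *)
rewrite nstairsC (@nstairs_stirling k) // subnn ltnS leq_min -[x <= p]ltnS ltn_ord andbT.
case: leqP => [le_xk | lt_kx].
  have lt_xk : x < k.+1 by [].
  rewrite (bigD1 (Ordinal lt_xk)) //= nstairs_base eqxx big1 => [|y neq_yx]; first by nia.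
  rewrite nstairs_base (_ : (_ == _) = false) ?muln0 //.
  by apply: contraNF neq_yx => /eqP yx; apply/eqP/val_inj.
rewrite big1 ?muln0 // => y _; rewrite nstairs_base (_ : (_ == _) = false) ?muln0 //.
by have := ltn_ord y; lia.
Qed.

(** * The board of permutations toppling to the identity *)

Definition label (r v : nat) : nat := if v.+1 < r then v.+1 else v.+2.

(** For [k < p] the chip is a right one, followed by [p - 1 - k] right chips. For [k >= p] it is a
    left one, preceded by [k - p + 1] left chips, chip [r] included. *)
Definition id_board (n p r : nat) : nat -> nat -> bool := fun k v =>
  if k < p then label r v + p <= n.+2 + k else k.+1 < label r v + p.

Lemma labelE r v : label r v = v.+2 - (v.+1 < r).
Proof. by rewrite /label; case: ltnP; rewrite ?subn0 ?subn1. Qed.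

Lemma id_boardE n p r k v : id_board n p r k v =
  ((p <= k) || (label r v + p <= n.+2 + k)) && ((k < p) || (k.+1 < label r v + p)).
Proof. by rewrite /id_board; case: ltnP => _ /=; rewrite ?andbT. Qed.

Lemma id_board1 n p : p <= n -> board_perms n (id_board n p 1) = polyBernB (n - p) p.
Proof.
move=> le_pn; rewrite -nstairs_polyBernB /nstairs !add0n subnKC //.
apply: eq_board_perms => k v lt_kn lt_vn.
by rewrite id_boardE stairsE labelE; lia.
Qed.

(** The labels for [r] and [r + 1] differ only in column [r - 1], being [r + 1] and [r] there. In
    rows [k < p] both meet the bound because [r + p <= n + 1]; among the other rows only [r + p - 1]
    separates them. *)
Lemma id_boardS n p r : 0 < r -> r + p <= n.+1 ->
  board_perms n.+1 (id_board n.+1 p r) =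
  board_perms n.+1 (id_board n.+1 p r.+1) + board_perms n (id_board n p r).
Proof.
move=> r_gt0 le_rn.
rewrite (@board_perms_del_cell n _ (id_board n.+1 p r.+1) (r + p).-1 r.-1); first last.
- move=> k v lt_k lt_v; rewrite !id_boardE !labelE; lia.
- by rewrite id_boardE labelE; lia.
- by rewrite id_boardE labelE; lia.
- by lia.
- by lia.
congr addn; apply: eq_board_perms => k v lt_k lt_v.
by rewrite /minor !id_boardE !labelE /bump; lia.
Qed.

(** By [id_boardS], raising [d] at size [n + 1] subtracts the count at size [n]; the arguments
    [n + 1 - p - d] and [n - p - d] are consecutive, so this is one forward difference. *)
Lemma id_board_fdiff n p d : d + p <= n ->
  ((board_perms n (id_board n p d.+1))%:Z
    = iter d fdiff (fun m => (polyBernB m p)%:Z) (n - p - d)%N)%R.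
Proof.
elim: d n => [|d IHd] [|n] // le_dn.
- by rewrite id_board1 // subn0.
- by rewrite id_board1 // subn0.
have E := id_boardS n p d.+1 isT le_dn.
have -> : n.+1 - p - d.+1 = n - p - d by lia.
rewrite iterS /fdiff -/fdiff; have {1}-> : (n - p - d).+1 = n.+1 - p - d by lia.
by rewrite -!IHd; lia.
Qed.

Lemma iter_fdiffE (f : nat -> int) d m :
  (iter d fdiff f m = \sum_(j < d.+1) (-1) ^+ (d - j) * ('C(d, j))%:Z * f (m + j)%N)%R.
Proof.
elim: d m => [|d IHd] m; first by rewrite big_ord1 /= bin0 expr0 !mul1r addn0.
rewrite iterS /fdiff -/fdiff !IHd [RHS]big_ord_recl.
(* Pascal's rule: the first half is the sum at [m + 1]; the second, with the term at 0, is minus the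
   sum at [m]. *)
rewrite [X in _ = (_ + X)%R](eq_bigr (fun j : 'I_d.+1 =>
  (-1) ^+ (d - j) * ('C(d, j))%:Z * f (m + j.+1)%N
  + (-1) ^+ (d - j) * ('C(d, j.+1))%:Z * f (m + j.+1)%N)%R); last first.
  by move=> j _; rewrite !lift0 subSS binS PoszD; ring.
rewrite big_split addrCA; congr (_ + _)%R.
  by apply: eq_bigr => j _; rewrite addSnnS.
rewrite big_ord_recl [X in _ = (_ + X)%R]big_ord_recr /= (@bin_small d d.+1) // mulr0 mul0r addr0.
rewrite opprD -sumrN; congr (_ + _)%R.
  by rewrite !bin0 !subn0 exprS; ring.
apply: eq_bigr => j _; rewrite /bump leq0n add1n.
have lt_jd := ltn_ord j.
have -> : (d - j = (d - j.+1).+1)%N by lia.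
by rewrite exprS; ring.
Qed.

(** * Toppling as sorting of words *)

(* In a word of labelled letters, the letter [true] (chip about to move right) at index [k]
   sits at site [k + 1] and the letter [false] (chip about to move left) sits at site [k]. *)
Definition word := seq (bool * nat).

Fixpoint sites (k : nat) (W : word) : seq (nat * nat) :=
  if W is (b, v) :: W' then (k + b, v) :: sites k.+1 W' else [::].

Definition at_site (L : seq (nat * nat)) (z : int) : seq nat :=
  [seq q.2 | q <- L & Posz q.1 == z].

(** Only up to order within a site, since toppling puts the moved chips at the head of the lists. *)
Definition represents (c : config) (W : word) : Prop :=
  forall z, perm_eq (c z) (at_site (sites 0 W) z).

Arguments sites : simpl never.

Lemma sites_cons k b v W : sites k ((b, v) :: W) = (k + b, v) :: sites k.+1 W.
Proof. by []. Qed.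

Lemma sites_cat k W1 W2 : sites k (W1 ++ W2) = sites k W1 ++ sites (k + size W1) W2.
Proof.
elim: W1 k => [|[b v] W1 IH] k; first by rewrite addn0.
by rewrite cat_cons !sites_cons IH addSnnS.
Qed.

Lemma at_site_cons q L z : at_site (q :: L) z = nseq (Posz q.1 == z) q.2 ++ at_site L z.
Proof. by rewrite /at_site /=; case: eqP. Qed.

Lemma at_site_cat L1 L2 z : at_site (L1 ++ L2) z = at_site L1 z ++ at_site L2 z.
Proof. by rewrite /at_site filter_cat map_cat. Qed.

Lemma at_site_lt k W z : (z < Posz k)%R -> at_site (sites k W) z = [::].
Proof.
elim: W k => [|[b v] W IH] k lt_zk //=; rewrite sites_cons at_site_cons IH ?cats0 /=; last by lia.
by rewrite (_ : (_ == _) = false) //; lia.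
Qed.

Lemma unzip2_sites k W : unzip2 (sites k W) = unzip2 W.
Proof. by elim: W k => [|[b v] W IH] k //; rewrite sites_cons /= IH. Qed.

(** Site [z] receives only a right letter at index [z - 1] or a left letter at index [z], so two
    chips there are adjacent letters. *)
Lemma at_site_two k W z (a b : nat) : a < b ->
  a \in at_site (sites k W) z -> b \in at_site (sites k W) z ->
  exists W1 x y W2, [/\ W = W1 ++ (true, x) :: (false, y) :: W2,
    z = Posz (k + size W1).+1, a = minn x y & b = maxn x y].
Proof.
move=> lt_ab; elim: W k => [|[[] v] W IH] k //=; rewrite sites_cons at_site_cons /=.
- case: eqP => [zE|_] /=; last first.
    move=> az bz; have [W1 [x [y [W2 [-> -> aE bE]]]]] := IH _ az bz.
    by exists ((true, v) :: W1), x, y, W2; split; rewrite //= addSnnS.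
  case: W {IH} => [|[[] w] W] /=; rewrite ?sites_cons ?at_site_cons /=.
  + by rewrite !inE; lia.
  + rewrite at_site_lt; last by lia.
    by rewrite (_ : (_ == _) = false) ?inE; lia.
  rewrite at_site_lt; last by lia.
  rewrite (_ : (_ == _) = true); last by lia.
  rewrite /= !inE => az bz; exists [::], v, w, W.
  by split; rewrite //=; move: zE az bz; lia.
case: eqP => [zE|_] /=; last first.
  move=> az bz; have [W1 [x [y [W2 [-> -> aE bE]]]]] := IH _ az bz.
  by exists ((false, v) :: W1), x, y, W2; split; rewrite //= addSnnS.
by rewrite at_site_lt ?inE; lia.
Qed.

(** With [m = size W1], both chips are at site [m + 1]. After the swap the left letter at index [m]
    is at site [m], and the right letter at index [m + 1] is at site [m + 2]. *)
Lemma represents_topple (c c' : config) W1 (x y : nat) W2 (i := Posz (size W1).+1) :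
  x != y -> represents c (W1 ++ (true, x) :: (false, y) :: W2) ->
  [/\ c' i = rem (minn x y) (rem (maxn x y) (c i)),
      c' (i - 1)%R = minn x y :: c (i - 1)%R,
      c' (i + 1)%R = maxn x y :: c (i + 1)%R &
      forall j, j != i -> j != (i - 1)%R -> j != (i + 1)%R -> c' j = c j] ->
  represents c' (W1 ++ (false, minn x y) :: (true, maxn x y) :: W2).
Proof.
move=> neq_xy repW [c'i c'l c'r c'E] z; apply/seq.permP => P; have := seq.permP (repW z) P.
rewrite !sites_cat !sites_cons !at_site_cat !at_site_cons /= !count_cat !count_nseq !mulnb.
have minmax : P x + P y = P (minn x y) + P (maxn x y) by case: leqP => //; lia.
have [->|ni] := eqVneq z i.
  have mem_c v : v \in c i = (v \in at_site (sites 0 (W1 ++ (true, x) :: (false, y) :: W2)) i).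
    exact: perm_mem (repW i) v.
  rewrite c'i !count_rem.
  have maxc : maxn x y \in c i.
    rewrite mem_c sites_cat !sites_cons at_site_cat mem_cat !at_site_cons !mem_cat /=.
    by rewrite !mem_nseq /i; lia.
  have minc : minn x y \in c i.
    rewrite mem_c sites_cat !sites_cons at_site_cat mem_cat !at_site_cons !mem_cat /=.
    by rewrite !mem_nseq /i; lia.
  have -> : minn x y \in rem (maxn x y) (c i).
    by have := perm_mem (perm_to_rem maxc) (minn x y);
      rewrite minc in_cons => /esym/orP[/eqP|//]; lia.
  rewrite maxc /i; case: (P x) (P y) (P (minn x y)) (P (maxn x y)) minmax => [] [] [] [] //=; lia.
have [->|nl] := eqVneq z (i - 1)%R; first by rewrite c'l /= /i;
  case: (P x) (P y) (P (minn x y)) (P (maxn x y)) minmax => [] [] [] [] //=; lia.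
have [->|nr] := eqVneq z (i + 1)%R; first by rewrite c'r /= /i;
  case: (P x) (P y) (P (minn x y)) (P (maxn x y)) minmax => [] [] [] [] //=; lia.
by rewrite c'E //; move: ni nl nr; rewrite /i;
  case: (P x) (P y) (P (minn x y)) (P (maxn x y)) minmax => [] [] [] [] //=; lia.
Qed.

Lemma topple_reach_invariant (Q : word -> Prop) c c' W :
  (forall W1 (x y : nat) W2, x != y -> Q (W1 ++ (true, x) :: (false, y) :: W2) ->
     Q (W1 ++ (false, minn x y) :: (true, maxn x y) :: W2)) ->
  topple_reach c c' -> represents c W -> Q W ->
  exists2 W', represents c' W' & Q W'.
Proof.
move=> Qswap reach; elim: reach W => {c c'} [c W | c c1 c2 step _ IH W] repW QW.
  by exists W.
case: step => i [a [b [[lt_ab ai bi] steps]]].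
have [W1 [x [y [W2 [WE iE aE bE]]]]] :=
  at_site_two _ _ _ _ _ lt_ab (etrans (esym (perm_mem (repW i) a)) ai)
    (etrans (esym (perm_mem (repW i) b)) bi).
have neq_xy : x != y by lia.
subst W i a b; apply: IH (Qswap _ _ _ _ neq_xy QW).
exact: represents_topple repW steps.
Qed.

Lemma swappable_or_sorted (W : word) :
  (exists W1 x y W2, W = W1 ++ (true, x) :: (false, y) :: W2) \/
  (exists xs ys, W = map (pair false) xs ++ map (pair true) ys).
Proof.
elim: W => [|[b v] W [[W1 [x [y [W2 ->]]]] | [xs [ys ->]]]].
- by right; exists [::], [::].
- by left; exists ((b, v) :: W1), x, y, W2.
case: b; last by right; exists (v :: xs), ys.
case: xs => [|x xs]; first by right; exists [::], (v :: ys).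
by left; exists [::], v, x, (map (pair false) xs ++ map (pair true) ys).
Qed.

Lemma at_site_swappable W1 x y W2 :
  1 < size (at_site (sites 0 (W1 ++ (true, x) :: (false, y) :: W2)) (size W1).+1).
Proof.
rewrite sites_cat !sites_cons at_site_cat !at_site_cons !size_cat !size_nseq /=; lia.
Qed.

Lemma sorted_not_swappable (xs ys : seq nat) (W1 W2 : word) x y :
  map (pair false) xs ++ map (pair true) ys <> W1 ++ (true, x) :: (false, y) :: W2.
Proof.
elim: xs W1 => [|x' xs IH] [|q W1] //=; last by case=> _; apply: IH.
  by case: ys => [|y1 [|y2 ys]].
move=> E; have : (false, y) \in map (pair true) ys.
  by rewrite E inE mem_cat !inE eqxx !orbT.
by case/mapP.
Qed.

Lemma size_at_site_sorted (xs ys : seq nat) z (W := map (pair false) xs ++ map (pair true) ys) :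
  uniq (unzip2 W) -> size (at_site (sites 0 W) z) <= 1.
Proof.
move=> UW; have: uniq (at_site (sites 0 W) z).
  by apply: subseq_uniq UW; rewrite -(unzip2_sites 0) map_subseq ?filter_subseq.
have two a b : a < b -> a \in at_site (sites 0 W) z -> b \in at_site (sites 0 W) z -> False.
  move=> lt_ab az bz; have [W1 [x [y [W2 [WE _ _ _]]]]] := at_site_two _ _ _ _ _ lt_ab az bz.
  exact: sorted_not_swappable WE.
case: (at_site _ _) two => [|a [|b s]] //= two.
rewrite inE negb_or => /andP[/andP[neq_ab _] _].
by case: (ltngtP a b) neq_ab => // /two; rewrite !inE !eqxx ?orbT => /(_ isT isT).
Qed.

(** Termination measure: each right letter counts the letters after it, so a swap lowers the total
    by one. *)
Fixpoint weight (W : word) : nat :=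
  if W is (b, _) :: W' then b * size W' + weight W' else 0.

Lemma weight_swap W1 x y x' y' W2 :
  weight (W1 ++ (false, x') :: (true, y') :: W2) <
  weight (W1 ++ (true, x) :: (false, y) :: W2).
Proof.
elim: W1 => [|[b v] W1 IH] /=; first by rewrite /=; lia.
by rewrite !size_cat /= ltn_add2l.
Qed.

Lemma topple_to_stable c W : represents c W -> uniq (unzip2 W) ->
  exists2 c', topple_reach c c' & stable c'.
Proof.
have [m] := ubnP (weight W); elim: m c W => // m IH c W; rewrite ltnS => le_Wm repW UW.
have [[W1 [x [y [W2 WE]]]] | [xs [ys WE]]] := swappable_or_sorted W; last first.
  exists c; first exact: reach_refl.
  by move=> z; rewrite (perm_size (repW z)) WE size_at_site_sorted // -WE.
rewrite {}WE in le_Wm repW UW; have neq_xy : x != y.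
  move: UW; rewrite /unzip2 map_cat cat_uniq /= inE.
  by case: eqVneq => //= _; rewrite !andbF.
pose i := Posz (size W1).+1.
pose c' j := if j == i then rem (minn x y) (rem (maxn x y) (c i))
  else if j == (i - 1)%R then minn x y :: c j
  else if j == (i + 1)%R then maxn x y :: c j else c j.
have steps : [/\ c' i = rem (minn x y) (rem (maxn x y) (c i)),
      c' (i - 1)%R = minn x y :: c (i - 1)%R,
      c' (i + 1)%R = maxn x y :: c (i + 1)%R &
      forall j, j != i -> j != (i - 1)%R -> j != (i + 1)%R -> c' j = c j].
  rewrite /c' !eqxx; split=> // [||j /negPf-> /negPf-> /negPf->//].
    by rewrite (_ : (_ == _) = false) //; lia.
  rewrite (_ : (_ == _) = false); last by lia.
  by rewrite (_ : (_ == _) = false) //; lia.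
have rep' := represents_topple _ _ _ _ _ _ neq_xy repW steps.
have [] := IH _ _ _ rep'.
- by have := weight_swap W1 x y (minn x y) (maxn x y) W2; lia.
- rewrite (@perm_uniq _ _ (unzip2 (W1 ++ (true, x) :: (false, y) :: W2))) //.
  rewrite /unzip2 !map_cat perm_cat2l /=; case: leqP => // _.
  by apply/seq.permP => P /=; rewrite addnCA.
move=> c'' reach st; exists c'' => //; apply: reach_step reach.
have mem_i v : v \in at_site (sites 0 (W1 ++ (true, x) :: (false, y) :: W2)) i -> v \in c i.
  by rewrite (perm_mem (repW i)).
exists i, (minn x y), (maxn x y); split; last exact: steps.
split; first by lia.
  apply: mem_i; rewrite sites_cat !sites_cons at_site_cat mem_cat !at_site_cons !mem_cat /=.
  by rewrite !mem_nseq /i; lia.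
apply: mem_i; rewrite sites_cat !sites_cons at_site_cat mem_cat !at_site_cons !mem_cat /=.
by rewrite !mem_nseq /i; lia.
Qed.

(** * The invariant *)

(* In the sorted final state, [N - v] chips follow chip [v] and [v - 1] precede it. The offsets
   [k] and [l] count the [true] letters after [W] and the [false] letters before [W]. *)
Fixpoint right_ok (N k : nat) (W : word) : bool :=
  if W is (_, v) :: W' then (v + count fst W' + k <= N) && right_ok N k W' else true.

Fixpoint left_ok (l : nat) (W : word) : bool :=
  if W is (b, v) :: W' then (l < v) && left_ok (l + ~~ b) W' else true.

Definition chips_ok (N : nat) (W : word) : bool := right_ok N 0 W && left_ok 0 W.

Lemma right_ok_cat N k W1 W2 :
  right_ok N k (W1 ++ W2) = right_ok N (k + count fst W2) W1 && right_ok N k W2.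
Proof.
elim: W1 => [|[b v] W1 IH] //=; rewrite IH count_cat andbA; congr (_ && _ && _).
by rewrite -!addnA (addnC k).
Qed.

Lemma left_ok_cat l W1 W2 :
  left_ok l (W1 ++ W2) = left_ok l W1 && left_ok (l + count (negb \o fst) W1) W2.
Proof.
by elim: W1 l => [|[b v] W1 IH] l /=; rewrite ?addn0 // IH addnA andbA.
Qed.

(** The counts seen from [W1] and [W2] do not change. For the swapped pair, the conditions after the
    swap ask [minn x y] and [maxn x y] for one unit more of slack, which [minn x y < maxn x y]
    supplies. *)
Lemma chips_ok_swap N W1 (x y : nat) W2 : x != y ->
  chips_ok N (W1 ++ (true, x) :: (false, y) :: W2) =
  chips_ok N (W1 ++ (false, minn x y) :: (true, maxn x y) :: W2).
Proof.
move=> neq_xy; rewrite /chips_ok !right_ok_cat !left_ok_cat /= !addn0.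
set u := count _ _; set l := 0 + _; case: (right_ok _ _ W1) => //=.
case: (left_ok _ W1); last by rewrite !andbF.
rewrite /= !add0n !add1n; case: (right_ok _ _ W2); last by rewrite !andbF.
case: (left_ok _ W2); last by rewrite !andbF.
by rewrite !andbT; lia.
Qed.

Lemma right_ok_false N k xs : right_ok N k (map (pair false) xs) = all (fun v => v + k <= N) xs.
Proof.
elim: xs => //= x xs ->; congr (_ && _).
by rewrite count_map (@eq_count _ _ pred0) // count_pred0 addn0.
Qed.

Lemma right_ok_true N k xs : reflect
  (forall j, j < size xs -> nth 0 xs j + (size xs - j.+1) + k <= N)
  (right_ok N k (map (pair true) xs)).
Proof.
apply: (iffP idP); elim: xs => [|x xs IH] //=; rewrite count_map.
  by rewrite (@eq_count _ _ predT) // count_predT => /andP[hx /IH h] [|j] /=; [lia | exact: h].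
move=> h; rewrite (@eq_count _ _ predT) // count_predT; have := h 0 isT.
rewrite /= subSS subn0 => -> /=; apply: IH => j; exact: (h j.+1).
Qed.

Lemma left_ok_true l xs : left_ok l (map (pair true) xs) = all (ltn l) xs.
Proof. by elim: xs => //= x xs; rewrite addn0 => ->. Qed.

Lemma left_ok_false l xs : reflect
  (forall j, j < size xs -> l + j < nth 0 xs j) (left_ok l (map (pair false) xs)).
Proof.
apply: (iffP idP); elim: xs l => [|x xs IH] l //=; rewrite addn1.
  by move=> /andP[hx /IH h] [|j] //=; rewrite ?addn0 // -addSnnS; apply: h.
move=> h; have := h 0 isT; rewrite addn0 /= => -> /=; apply: IH => j lt_j.
by rewrite addSnnS; apply: (h j.+1).
Qed.

(** The last entry is forced to be the length; distinctness then lowers the upper bound for the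
    others. *)
Lemma uniq_lower_iota (xs : seq nat) : uniq xs ->
  (forall j, j < size xs -> j < nth 0 xs j <= size xs) -> xs = iota 1 (size xs).
Proof.
elim/last_ind: xs => // xs x IH; rewrite rcons_uniq size_rcons => /andP[xNxs Uxs] h.
have xE : x = (size xs).+1.
  by have := h (size xs) (ltnSn _); rewrite nth_rcons ltnn eqxx; lia.
rewrite [in LHS]IH //; first by rewrite -[(size xs).+1]addn1 iotaD xE cats1.
move=> j lt_j; have := h j (ltnW lt_j); rewrite nth_rcons lt_j => /andP[-> /=].
rewrite leq_eqVlt => /orP[/eqP nE|//].
by case/negP: xNxs; rewrite xE -nE mem_nth.
Qed.

Lemma uniq_upper_iota g (xs : seq nat) : uniq xs ->
  (forall j, j < size xs -> g <= nth 0 xs j <= g + j) -> xs = iota g (size xs).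
Proof.
elim: xs g => // x xs IH g /= /andP[xNxs Uxs] h.
have xE : x = g by have := h 0 isT; rewrite /=; lia.
rewrite xE -IH // => j lt_j; have := h j.+1 lt_j; rewrite /= addnS => /andP[le_g ->].
rewrite andbT ltn_neqAle le_g andbT; apply: contraNneq xNxs => gE.
by rewrite xE gE mem_nth.
Qed.

(** The left chips lie in [1..size xs] with entry [j] above [j]; the right chips lie above [size xs]
    with entry [j] at most [size xs + 1 + j]. Distinctness pins down both runs. *)
Lemma chips_ok_sorted (xs ys : seq nat) : uniq (xs ++ ys) ->
  chips_ok (size xs + size ys) (map (pair false) xs ++ map (pair true) ys) <->
  xs ++ ys = iota 1 (size xs + size ys).
Proof.
set N := size xs + size ys; rewrite /chips_ok right_ok_cat left_ok_cat.
have -> : count fst (map (pair true) ys) = size ys.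
  by rewrite count_map (@eq_count _ _ predT) ?count_predT.
have -> : count (negb \o fst) (map (pair false) xs) = size xs.
  by rewrite count_map (@eq_count _ _ predT) ?count_predT.
rewrite right_ok_false left_ok_true !add0n cat_uniq => /and3P[Uxs _ Uys]; split.
  case/andP=> /andP[/all_nthP-/(_ 0) xs_le /right_ok_true ys_le].
  case/andP=> /left_ok_false xs_ge /all_nthP-/(_ 0) ys_ge.
  rewrite iotaD -(@uniq_lower_iota xs) // -?(@uniq_upper_iota _ ys) //.
  - by move=> j lt_j; have := ys_le j lt_j; have := ys_ge j lt_j; rewrite /N /=; lia.
  - by move=> j lt_j; have := xs_le j lt_j; have := xs_ge j lt_j; rewrite /N /=; lia.
move/eqP; rewrite iotaD eqseq_cat ?size_iota // => /andP[/eqP xsE /eqP ysE].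
apply/andP; split; apply/andP; split.
- by apply/allP => v; rewrite xsE mem_iota /N; lia.
- by apply/right_ok_true => j lt_j; rewrite {1}ysE nth_iota // /N; lia.
- by apply/left_ok_false => j lt_j; rewrite {1}xsE nth_iota.
- by apply/allP => v; rewrite ysE mem_iota /=; lia.
Qed.

Lemma path_sites m k W : m <= k -> path leq m (unzip1 (sites k W)).
Proof.
elim: W m k => [|[b v] W IH] m k le_mk //; rewrite sites_cons /= IH; last by case: b; lia.
by rewrite andbT (leq_trans le_mk) ?leq_addr.
Qed.

Lemma sites_le k W q : q \in sites k W -> q.1 <= k + size W.
Proof.
elim: W k => [|[b v] W IH] k //; rewrite sites_cons inE => /orP[/eqP->|/IH] /=; last by lia.
by case: b; lia.
Qed.

(** As sites weakly increase along [L], collecting the chips site by site preserves their order. *)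
Lemma flatten_at_site L m len : path leq m (unzip1 L) ->
  (forall q, q \in L -> q.1 < m + len) ->
  flatten [seq at_site L (Posz i) | i <- iota m len] = unzip2 L.
Proof.
elim: L => [|[s v] L IH] /=.
  move=> _ _; elim: len m => //= len IHlen m; exact: IHlen.
case/andP=> le_ms sL lt_L.
have lt_s : s < m + len by apply: (lt_L (s, v)); rewrite inE eqxx.
have L0 i : i < s -> at_site L (Posz i) = [::].
  move=> lt_is; apply/eqP; rewrite -size_eq0 size_map size_filter -leqn0 leqNgt -has_count.
  apply/hasPn => q /(map_f fst) /(allP (order_path_min leq_trans sL)) /= le_sq.
  by apply/eqP; lia.
rewrite -IH; first last.
- by move=> q Lq; apply: lt_L; rewrite inE Lq orbT.
- by apply: path_le sL => //; exact: leq_trans.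
have -> : len = (s - m) + (1 + (m + len - s.+1)) by lia.
rewrite !iotaD !map_cat !flatten_cat subnKC //= !at_site_cons /= eqxx !cats0.
have low F : (forall i, i < s -> F i = [::] :> seq nat) ->
    flatten [seq F i | i <- iota m (s - m)] = [::].
  move=> F0; rewrite (@eq_in_map _ _ F (fun=> [::]) _).1; first by elim: (iota _ _).
  by move=> i; rewrite mem_iota => hi; apply: F0; lia.
rewrite !low //=.
  congr (_ :: _ ++ flatten _); apply/eq_in_map => i; rewrite mem_iota at_site_cons /= => hi.
  by rewrite (_ : (_ == _) = false) //; lia.
by move=> i lt_i; rewrite at_site_cons L0 //= (_ : (_ == _) = false) //; lia.
Qed.

Lemma reading_represents n c W : size W = n.+1 -> stable c -> represents c W ->
  reading n c = unzip2 W.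
Proof.
move=> sizeW st repW; rewrite -(unzip2_sites 0) -(@flatten_at_site _ 0 n.+2).
(* Stability turns the equality up to permutation into equality, each site holding at most one
   chip. *)
- rewrite /reading; congr flatten; apply: eq_map => i; apply: perm_small_eq (repW i).
  by rewrite -(perm_size (repW i)) st.
- exact: path_sites.
- by move=> q /sites_le; rewrite sizeW.
Qed.

(** * The initial configuration *)

Definition init_label (n r : nat) (s : 'S_n) (k : nat) : nat :=
  if insub k is Some o then label r (s o) else 0.

(** Sites [1..p] carry right letters at indices [0..p-1]. Chip [r] is the left letter at index [p],
    sharing site [p] with the last of them; sites [p+1..n] carry left letters at their own index. *)
Definition init_word (n p r : nat) (s : 'S_n) : word :=
  map (pair true) (map (init_label n r s) (iota 0 p)) ++
  map (pair false) (r :: map (init_label n r s) (iota p (n - p))).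

Lemma init_labelE n r (s : 'S_n) (k : 'I_n) : init_label n r s k = label r (s k).
Proof. by rewrite /init_label valK. Qed.

Lemma at_site_map_iota b k f m len i :
  at_site (sites (m + k) (map (pair b) (map f (iota m len)))) (Posz i) =
  nseq (m + k + b <= i < m + k + b + len) (f (i - (k + b))).
Proof.
elim: len m => [|len IH] m; first by rewrite (_ : _ && _ = false) //; lia.
rewrite [iota _ _]/= !map_cons sites_cons at_site_cons -addSn IH /=.
have [iE|ne] := eqVneq i (m + k + b).
  rewrite (_ : (Posz _ == _) = true); last by lia.
  rewrite (_ : (_ <= i < _) = false); last by lia.
  by rewrite (_ : (_ <= i < _) = true) ?cats0; [congr nseq; congr f|]; lia.
rewrite (_ : (Posz _ == _) = false) /=; last by lia.
by congr nseq; lia.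
Qed.

Lemma represents_init n p r (s : 'S_n) : 1 <= p <= n ->
  represents (init_config n p r s) (init_word n p r s).
Proof.
case/andP=> p_gt0 le_pn [i|i]; last first.
  rewrite (_ : at_site _ _ = [::]) //; rewrite /at_site.
  by elim: (sites _ _) => //= q L IH.
rewrite /init_word sites_cat at_site_cat map_cons sites_cons at_site_cons !size_map size_iota.
rewrite (at_site_map_iota true 0 _ 0 p) (_ : (0 + p).+1 = p + 1) ?(at_site_map_iota false 1 _ p);
  last by rewrite addn1.
apply/seq.permP => P; rewrite !count_cat !count_nseq /= !addn0 !add0n !mulnb.
case: i => [|i]; first by case: p p_gt0 le_pn => //= p _ _; rewrite !andbF.
have -> : count P (if i.+1 == p then [:: r] else [::]) = P r && (i.+1 == p).
  by case: eqP; rewrite /= ?addn0 ?andbT ?andbF.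
rewrite /= subSS subn0 {1}/init_label /label; case: insubP => [k lt_in kE | ge_in] /=.
  rewrite addn0 /init_label /label -kE valK kE.
  case: (P r) (P _) => [] [] /=; lia.
by case: (P r) (P _) => [] [] /=; lia.
Qed.

Lemma unzip2_pair (b : bool) (xs : seq nat) : unzip2 (map (pair b) xs) = xs.
Proof. by elim: xs => //= x xs ->. Qed.

Lemma unzip2_cat (W1 W2 : word) : unzip2 (W1 ++ W2) = unzip2 W1 ++ unzip2 W2.
Proof. exact: map_cat. Qed.

Lemma unzip2_init n p r (s : 'S_n) : p <= n ->
  perm_eq (unzip2 (init_word n p r s)) (r :: map (init_label n r s) (iota 0 n)).
Proof.
move=> le_pn; rewrite /init_word unzip2_cat !unzip2_pair.
have -> : iota 0 n = iota 0 p ++ iota p (n - p) by rewrite -{1}(subnKC le_pn) iotaD.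
rewrite map_cat.
by apply/seq.permP => P; rewrite /= !count_cat /=; lia.
Qed.

Lemma uniq_init n p r (s : 'S_n) : p <= n -> uniq (unzip2 (init_word n p r s)).
Proof.
move=> le_pn; rewrite (perm_uniq (unzip2_init _ _ _ _ le_pn)) /=.
have lab k : k < n -> exists2 o : 'I_n, k = o & init_label n r s k = label r (s o).
  by move=> lt_kn; exists (Ordinal lt_kn); rewrite // -init_labelE.
apply/andP; split.
  by apply/mapP => -[k]; rewrite mem_iota => /lab[o _ ->]; rewrite labelE; lia.
rewrite map_inj_in_uniq ?iota_uniq // => k l; rewrite !mem_iota.
move=> /lab[o -> ->] /lab[o' -> ->]; rewrite !labelE => E; congr nat_of_ord.
by apply: (@perm_inj _ s); apply: val_inj; move: E => /=; lia.
Qed.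

Lemma size_init n p r (s : 'S_n) : p <= n -> size (init_word n p r s) = n.+1.
Proof. by move=> le_pn; rewrite size_cat /= !size_map !size_iota; lia. Qed.

(** All labels lie in [1..n+1], which settles the left condition for right chips, the right
    condition for left chips, and both for chip [r]. What remains is the board. *)
Lemma chips_ok_init n p r (s : 'S_n) : p <= n -> 1 <= r <= n - p + 1 ->
  chips_ok n.+1 (init_word n p r s) = [forall k : 'I_n, id_board n p r k (s k)].
Proof.
move=> le_pn /andP[r_gt0 le_r].
have lab k : k < n -> exists2 o : 'I_n, k = o & init_label n r s k = label r (s o).
  by move=> lt_kn; exists (Ordinal lt_kn); rewrite // -init_labelE.
have lab_bd k : k < n -> 0 < init_label n r s k <= n.+1.
  by move=> /lab[o _ ->]; rewrite labelE; have := ltn_ord (s o); lia.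
have count0 (xs : seq nat) : count fst (map (pair false) xs) = 0.
  by rewrite count_map (@eq_count _ _ pred0) ?count_pred0.
have countT (xs : seq nat) : count (negb \o fst) (map (pair true) xs) = 0.
  by rewrite count_map (@eq_count _ _ pred0) ?count_pred0.
rewrite /chips_ok /init_word right_ok_cat left_ok_cat count0 countT !addn0.
rewrite right_ok_false left_ok_true.
have -> : all (fun v => v + 0 <= n.+1) (r :: map (init_label n r s) (iota p (n - p))).
  rewrite /= addn0; apply/andP; split; first by lia.
  apply/allP => v /mapP[k]; rewrite mem_iota => hk ->.
  by have := lab_bd k; lia.
have -> : all (ltn 0) (map (init_label n r s) (iota 0 p)).
  by apply/allP => v /mapP[k]; rewrite mem_iota => hk -> /=; have := lab_bd k; lia.
rewrite andbT /= r_gt0 /=; apply/andP/forallP => [[/right_ok_true R /left_ok_false L] k | H].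
  rewrite id_boardE -init_labelE; move: R L; rewrite !size_map !size_iota => R L.
  have lt_k := ltn_ord k; have [lt_kp | le_pk] := ltnP k p.
    have := R k lt_kp; rewrite (nth_map 0) ?size_iota // nth_iota // add0n; lia.
  have lt_kp : k - p < n - p by lia.
  have := L _ lt_kp; rewrite (nth_map 0) ?size_iota // nth_iota // subnKC //; lia.
split.
  apply/right_ok_true => j; rewrite size_map size_iota => lt_jp.
  rewrite (nth_map 0) ?size_iota // nth_iota // add0n.
  have [o jE ->] := lab j (leq_trans lt_jp le_pn).
  by have := H o; rewrite id_boardE -jE; lia.
apply/left_ok_false => j; rewrite size_map size_iota => lt_j.
rewrite (nth_map 0) ?size_iota // nth_iota //.
have lt_pj : p + j < n by lia.
have [o jE ->] := lab _ lt_pj.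
by have := H o; rewrite id_boardE -jE; lia.
Qed.

(** * Characterization of the permutations toppling to the identity, and their number *)

Lemma in_T_id_board n p r (s : 'S_n) : 1 <= p <= n -> 1 <= r <= n - p + 1 ->
  [forall k : 'I_n, id_board n p r k (s k)] <-> in_T n p r s.
Proof.
move=> p_bd r_bd; have le_pn : p <= n by case/andP: p_bd.
set W0 := init_word n p r s; set L0 := unzip2 W0.
have repW0 : represents (init_config n p r s) W0 by exact: represents_init.
have U0 : uniq L0 by exact: uniq_init.
(* The label multiset is carried along because [chips_ok_sorted] needs distinct labels in the final
   word. *)
pose Q W := perm_eq (unzip2 W) L0 /\ chips_ok n.+1 W = chips_ok n.+1 W0.
(* Stated for every stable outcome: one direction uses the outcome given by [in_T], the other the
   one from [topple_to_stable]. *)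
have final c : topple_reach (init_config n p r s) c -> stable c ->
    (reading n c = iota 1 n.+1 <-> chips_ok n.+1 W0).
  move=> reach st.
  have [|//|W repW [permW <-]] := topple_reach_invariant Q _ _ _ _ reach repW0.
    move=> W1 x y W2 neq_xy [permW okW]; split; last by rewrite -chips_ok_swap.
    apply: perm_trans permW; rewrite /unzip2 !map_cat perm_cat2l /=; case: leqP => // _.
    by apply/seq.permP => P /=; rewrite addnCA.
  have sizeW : size W = n.+1.
    by rewrite -(size_map snd) (perm_size permW) size_map size_init.
  rewrite (reading_represents _ _ _ sizeW st repW).
  have [[W1 [x [y [W2 WE]]]] | [xs [ys WE]]] := swappable_or_sorted W.
    have := st (size W1).+1; rewrite (perm_size (repW _)) WE leqNgt.
    by rewrite at_site_swappable.
  have WL : unzip2 W = xs ++ ys by rewrite WE unzip2_cat !unzip2_pair.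
  have Uxy : uniq (xs ++ ys) by rewrite -WL (perm_uniq permW).
  have sizexy : n.+1 = size xs + size ys by rewrite -sizeW WE size_cat !size_map.
  by rewrite WL WE sizexy; split; move/chips_ok_sorted; apply.
rewrite -chips_ok_init //; split=> [ok0 | [c [reach st /(final _ reach st)]] //].
have [c reach st] := topple_to_stable _ _ repW0 U0.
by exists c; split=> //; apply/(final _ reach st).
Qed.

Theorem theorem2p6 (n p r : nat) :
  (1 <= p <= n)%N -> (1 <= r <= n - p + 1)%N ->
  exists T : {set 'S_n},
    (forall s : 'S_n, s \in T <-> in_T n p r s) /\
    (#|T|%:Z = iter r.-1 fdiff (fun m => (polyBernB m p)%:Z) (n - p + 1 - r)%N)%R /\
    (#|T|%:Z = \sum_(j < r)
        ((-1) ^+ (r.-1 - j) * ('C(r.-1, j))%:Z * (polyBernB (n - p + 1 - r + j) p)%:Z))%R.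
Proof.
move=> p_bd r_bd; exists [set s : 'S_n | [forall k : 'I_n, id_board n p r k (s k)]].
split; first by move=> s; rewrite inE; apply: in_T_id_board.
have -> : #|[set s : 'S_n | [forall k : 'I_n, id_board n p r k (s k)]]|
    = board_perms n (id_board n p r).
  rewrite -sum1_card big_mkcond; apply: eq_bigr => s _; rewrite inE.
  by case: [forall k, _].
case: r r_bd => // d /andP[_ le_d].
have E : n - p + 1 - d.+1 = n - p - d by lia.
rewrite id_board_fdiff ?E; last by lia.
by rewrite iter_fdiffE.
Qed.
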